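(* Let $G$ be a fullerene. Then every connected component of the resonance graph of $G$ is a median graph.
   Context: A fullerene is a (finite, simple) cubic, 3-connected plane graph all of whose faces are pentagons and hexagons; the plane embedding is regarded as an embedding in the sphere, so the unbounded face is included among the faces. A perfect matching of $G$ is a set of edges incident with each vertex exactly once. The resonance graph of a fullerene $G$ has the perfect matchings of $G$ as vertices, with $M$ adjacent to $N$ precisely when the symmetric difference $M\triangle N$ is the edge set of the boundary cycle of some hexagonal face of $G$. For a connected graph $H$ with graph distance $d_H$, put $I_H(x,y)=\{z\in V(H): d_H(x,z)+d_H(z,y)=d_H(x,y)\}$. The graph $H$ is median if $I_H(x,y)\cap I_H(y,z)\cap I_H(z,x)$ contains exactly one vertex for every triple $x,y,z$ of vertices. *)

(* Defs.v *)
From mathcomp Require Import all_boot all_fingroup.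

Set Implicit Arguments.
Unset Strict Implicit.
Unset Printing Implicit Defensive.

Record sgraph := SGraph {
  vertex :> finType;
  adj : rel vertex;
  adj_sym : symmetric adj;
  adj_irrefl : irreflexive adj }.

Section Graphs.

Variable H : sgraph.
Implicit Types (x y z : H) (A S : {set H}).

Definition neighbours x : {set H} := [set y | adj x y].

Definition edges : {set {set H}} :=
  [set [set d.1; d.2] | d : H * H & adj d.1 d.2].

Definition connected_graph : Prop := forall x y, connect (@adj H) x y.

Definition components : {set {set H}} :=
  [set [set y | connect (@adj H) x y] | x : H].

Definition cubic : Prop := forall x, #|neighbours x| = 3.

Definition induced_adj A : rel {x : H | x \in A} :=
  fun u v => adj (val u) (val v).

Lemma induced_adj_sym A : symmetric (@induced_adj A).
Proof. by move=> u v; apply: adj_sym. Qed.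

Lemma induced_adj_irrefl A : irreflexive (@induced_adj A).
Proof. by move=> u; apply: adj_irrefl. Qed.

Definition induced A : sgraph :=
  SGraph (@induced_adj_sym A) (@induced_adj_irrefl A).

Definition walk x y (n : nat) : bool :=
  [exists p : n.-tuple H, path (@adj H) x p && (last x p == y)].

(** The least length of a walk from [x] to [y].  A shortest walk has fewer than
    [#|H|] edges, so the search is exhaustive; the junk value [#|H|] is
    returned exactly when [x] and [y] lie in different components. *)
Definition gdist x y : nat := find (walk x y) (iota 0 #|H|).

Definition interval x y : {set H} :=
  [set z | gdist x z + gdist z y == gdist x y].

Definition median : Prop :=
  connected_graph /\
  forall x y z, #|interval x y :&: interval y z :&: interval z x| = 1.

Definition perfect_matching (M : {set {set H}}) : bool :=
  (M \subset edges) && [forall x, #|[set e in M | x \in e]| == 1].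

End Graphs.

Definition k_connected (k : nat) (H : sgraph) : Prop :=
  k < #|H| /\ forall S : {set H}, #|S| < k -> connected_graph (induced (~: S)).

(** Plane graphs are given combinatorially.

    A cellular embedding of a connected graph in an oriented closed surface is
    given, up to orientation-preserving homeomorphism, by its rotation system:
    the cyclic order [rot v] of the neighbours around each vertex [v].  The
    faces are the orbits of face tracing on the darts (ordered pairs of adjacent
    vertices), and the surface is the sphere exactly when V - E + F = 2.  All
    faces, the unbounded one included, are on the same footing.  The value of
    [rot v] outside the neighbourhood of [v] is irrelevant.  The one-vertex
    graph, which has no dart and so no orbit for its face, is left out. *)

Section Rotation.

Variables (H : sgraph) (rot : H -> {perm H}).

Definition rotation_system : Prop :=
  forall v u, adj v u -> porbit (rot v) u = neighbours v.

Definition face_step (d : H * H) : H * H := (d.2, rot d.2 d.1).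

Definition face_set : {set {set H * H}} :=
  [set [set d' | fconnect face_step d d'] | d : H * H & adj d.1 d.2].

Definition spherical : Prop :=
  connected_graph H /\ #|H| + #|face_set| = #|edges H| + 2.

End Rotation.

Record plane_graph := PlaneGraph {
  underlying :> sgraph;
  rot : underlying -> {perm underlying};
  rot_system : rotation_system rot;
  rot_spherical : spherical rot }.

Definition faces (G : plane_graph) : {set {set G * G}} := face_set (@rot G).

Definition boundary (G : plane_graph) (F : {set G * G}) : {set {set G}} :=
  [set [set d.1; d.2] | d in F].

(** The face [F] is bounded by a cycle of length [k]: its boundary walk has
    length [k] and visits [k] distinct vertices. *)
Definition is_gon (k : nat) (G : plane_graph) (F : {set G * G}) : bool :=
  (#|F| == k) && (#|[set d.1 | d in F]| == k).

Definition fullerene (G : plane_graph) : Prop :=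
  [/\ cubic G, k_connected 3 G
    & forall F, F \in faces G -> is_gon 5 F || is_gon 6 F].

Section Resonance.

Variable G : plane_graph.

Definition matching := {M : {set {set G}} | perfect_matching M}.

Definition resonant (M N : matching) : bool :=
  [exists F in faces G, is_gon 6 F &&
     ((val M :\: val N) :|: (val N :\: val M) == boundary F)].

Lemma resonant_sym : symmetric resonant.
Proof. by move=> M N; apply: eq_existsb => F; rewrite setUC. Qed.

Lemma resonant_irrefl : irreflexive resonant.
Proof.
rewrite /resonant => M; apply/negbTE/negP => /exists_inP[F _ /andP[/andP[/eqP cF _]]].
have /card_gt0P [d dF] : 0 < #|F| by rewrite cF.
rewrite setDv setU0 eq_sym => /eqP B0.
have := imset_f (fun d : G * G => [set d.1; d.2]) dF.
by rewrite -/(boundary F) B0 inE.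
Qed.

Definition resonance_graph : sgraph := SGraph resonant_sym resonant_irrefl.

End Resonance.

(* Main.v *)
Require Import Defs.
From mathcomp Require Import all_boot all_fingroup all_order all_algebra boolp zify.

(** A flip of a hexagon changes the membership of its edges with alternating
    signs.  Accumulating these signs along a sequence of flips gives a function
    [k] on darts, antisymmetric under face tracing, such that
    [k d + k (drev d)] is the change in membership of the edge of [d].  On a
    pentagon, whose length is odd, [k] vanishes; since a fullerene has a pentagon
    (Euler) and is connected, [k] is determined by the two matchings, and two
    matchings are resonant exactly when the l1 norm of their [k] is 6.

    The constraints [0 <= m + k d + k (drev d) <= 1] involve two coordinates
    each, so their integral solutions are closed under coordinatewise medians.
    Finally, in a median-closed set of integer vectors every component of the
    unit-step graph is isometric: applying [med x y -] to a path from [x] to [y]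
    moves it into the box spanned by [x] and [y], where its first step is a step
    of a geodesic. *)

Set Implicit Arguments.
Unset Strict Implicit.
Unset Printing Implicit Defensive.

Import GRing.Theory.

(** * Medians of three integers *)

Definition medz (a b c : int) : int :=
  Order.max (Order.min a b) (Order.min (Order.max a b) c).

Lemma medz_rot a b c : medz a b c = medz b c a.
Proof. by rewrite /medz; lia. Qed.

(** For fixed [a] and [b] the median clamps [c] to the interval they span, and clamping is
    nonexpansive. *)
Lemma medz_lipschitz a b c c' : `|medz a b c - medz a b c'| <= `|c - c'|.
Proof. by rewrite /medz; lia. Qed.

Lemma medz_between a b c : `|a - medz a b c| + `|medz a b c - b| = `|a - b|.
Proof. by rewrite /medz; lia. Qed.

Lemma medz_unique a b c x :
  `|a - x| + `|x - b| = `|a - b| -> `|b - x| + `|x - c| = `|b - c| ->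
  `|c - x| + `|x - a| = `|c - a| -> x = medz a b c.
Proof. by rewrite /medz; lia. Qed.

(** * Graph distance through shortest walks *)

Section Distance.

Variable H : sgraph.
Implicit Types x y z : H.

Lemma walkP x y n :
  reflect (exists p, [/\ size p = n, path (@adj H) x p & last x p = y])
          (walk x y n).
Proof.
apply: (iffP existsP) => [[p /andP[xp /eqP py]]|[p [sp xp py]]].
  by exists p; rewrite size_tuple.
by exists (tcast sp (in_tuple p)); rewrite val_tcast xp py eqxx.
Qed.

Lemma gdist_min_walk x y n :
  walk x y n -> (forall m, walk x y m -> n <= m) -> gdist x y = n.
Proof.
move=> xyn n_min.
(* A walk of least length is no longer than a simple path, so [n] lies in the range that [gdist]
   searches. *)
have n_lt : n < #|H|.
  have /walkP[p [_ xp]] := xyn; case: (shortenP xp) => p' xp' up' _ py.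
  have xyp' : walk x y (size p') by apply/walkP; exists p'.
  by apply: leq_ltn_trans (n_min _ xyp') _;
    have := max_card (mem (x :: p')); rewrite (card_uniqP up').
have hw : has (walk x y) (iota 0 #|H|) by apply/hasP; exists n => //; rewrite mem_iota.
have lt_find : gdist x y < #|H| by move: hw; rewrite has_find size_iota.
have walk_find := nth_find 0 hw; rewrite nth_iota // add0n in walk_find.
apply/eqP; rewrite eqn_leq n_min // andbT leqNgt; apply/negP => lt_n.
by have := before_find 0 lt_n; rewrite nth_iota // add0n xyn.
Qed.

End Distance.

(** * Components inside a median-closed set of integer vectors *)

Section MedianStable.

Variables (R : sgraph) (T : finType) (S : {set R}) (phi : R -> T -> int) (c : nat).
Hypothesis c_gt0 : 0 < c.

Definition l1dist (x y : R) : nat := \sum_t `|phi x t - phi y t|.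

Hypothesis adj_l1 : {in S &, forall x y, adj x y = (l1dist x y == c)}.
Hypothesis l1_gap : {in S &, forall x y, x != y -> c <= l1dist x y}.
Hypothesis S_median : {in S & &, forall x y z, exists2 w, w \in S &
  forall t, phi w t = medz (phi x t) (phi y t) (phi z t)}.

Lemma l1dist_triangle y x z : l1dist x z <= l1dist x y + l1dist y z.
Proof. by rewrite -big_split leq_sum // => t _ /=; lia. Qed.

(** Each coordinate obeys the triangle inequality, so equality of the sums forces equality in every
    term. *)
Lemma l1dist_tight x y z : l1dist x y + l1dist y z = l1dist x z ->
  forall t, `|phi x t - phi y t| + `|phi y t - phi z t| = `|phi x t - phi z t|.
Proof.
move/esym/eqP; rewrite -big_split /=.
have le_t t : true -> `|phi x t - phi z t| <= `|phi x t - phi y t| + `|phi y t - phi z t| by lia.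
have := leqif_sum (P := predT) (fun t pt => leqif_eq (le_t t pt)).
by move=> [_ ->] /forallP tight t; apply/esym/eqP/tight.
Qed.

Lemma phi_inj x y : x \in S -> y \in S -> phi x =1 phi y -> x = y.
Proof.
move=> Sx Sy eq_phi; apply/eqP/negPn/negP => /(l1_gap Sx Sy).
by rewrite leqNgt /l1dist big1 ?c_gt0 // => t _; rewrite eq_phi subrr.
Qed.

(** The default [x] is never reached on [S], where [S_median] supplies a witness and [phi_inj] makes
    it unique. *)
Definition med (x y z : R) : R := odflt x
  [pick w in S | [forall t, phi w t == medz (phi x t) (phi y t) (phi z t)]].

Lemma medP : {in S & &, forall x y z, med x y z \in S /\
  forall t, phi (med x y z) t = medz (phi x t) (phi y t) (phi z t)}.
Proof.
move=> x y z Sx Sy Sz; rewrite /med; case: pickP => [w /andP[Sw /forallP w_med]|no_med].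
  by split=> // t; apply/eqP.
have [w Sw w_med] := S_median Sx Sy Sz.
by have /andP[] := no_med w; split=> //; apply/forallP=> t; rewrite w_med.
Qed.

Lemma medxyx x y : x \in S -> y \in S -> med x y x = x.
Proof.
move=> Sx Sy; have [Sm mE] := medP Sx Sy Sx.
by apply: phi_inj => // t; rewrite mE /medz; lia.
Qed.

Lemma medxyy x y : x \in S -> y \in S -> med x y y = y.
Proof.
move=> Sx Sy; have [Sm mE] := medP Sx Sy Sy.
by apply: phi_inj => // t; rewrite mE /medz; lia.
Qed.

(** Nonexpansiveness bounds the distance of the two medians above by [c]; the gap bounds it below by
    [c] once they differ. *)
Lemma med_adj x y p q : x \in S -> y \in S -> p \in S -> q \in S ->
  adj p q -> med x y p != med x y q -> adj (med x y p) (med x y q).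
Proof.
move=> Sx Sy Sp Sq; rewrite adj_l1 // => /eqP pq.
have [Sm mE] := medP Sx Sy Sp; have [Sm' mE'] := medP Sx Sy Sq.
move=> /(l1_gap Sm Sm') ge_c; rewrite adj_l1 // eqn_leq ge_c andbT -pq.
by apply: leq_sum => t _; rewrite mE mE' medz_lipschitz.
Qed.

Variable C : {set R}.
Hypothesis C_comp : C \in components R.
Hypothesis C_sub : C \subset S.

Let CS x : x \in C -> x \in S. Proof. exact: (subsetP C_sub). Qed.

Lemma component_connect x y : x \in C -> (y \in C) = connect (@adj R) x y.
Proof.
have symR : connect_sym (@adj R) by apply: sym_connect_sym; apply: adj_sym.
have /imsetP[z _ ->] := C_comp; rewrite !inE => zx.
by rewrite (same_connect symR zx).
Qed.

Lemma component_adj x y : x \in C -> adj x y -> y \in C.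
Proof. by move=> Cx xy; rewrite (component_connect _ Cx) connect1. Qed.

(** As the last argument runs along a path from [x] to [z], the median starts at [x] and only rests
    or crosses edges. *)
Lemma med_component x y z : x \in C -> y \in C -> z \in C -> med x y z \in C.
Proof.
move=> Cx Cy Cz.
have : med x y x \in C by rewrite medxyx ?CS.
have /connectP[p xp ->] : connect (@adj R) x z by rewrite -component_connect.
elim: p {1 2 4 6}x (Cx) xp => //= q p IHp w Cw /andP[wq qp] Cm.
have Cq := component_adj Cw wq; apply: IHp => //.
have [<- //|neq] := eqVneq (med x y w) (med x y q).
by apply: component_adj Cm _; apply: med_adj neq => //; apply: CS.
Qed.

(** Along a path from [x] to [y] the median [med x y -] goes from [x] to [y]. Where it first leaves
    [x] it enters a neighbour of [x] in the box spanned by [x] and [y], so distances add up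
    there. *)
Lemma component_step x y : x \in C -> y \in C -> x != y ->
  exists w, [/\ w \in C, adj x w & l1dist x y = c + l1dist w y].
Proof.
move=> Cx Cy neq_xy.
have [q Cq adj_q] : exists2 q, q \in C & adj x (med x y q).
  have /connectP[p xp lastp] : connect (@adj R) x y by rewrite -component_connect.
  have := medxyx (CS Cx) (CS Cy).
  elim: p {1 2 3 5}x (Cx) xp lastp => [|q p IHp] w Cw /=.
    by move=> _ <-; rewrite medxyy ?CS // => /eqP; rewrite eq_sym (negPf neq_xy).
  move=> /andP[wq qp] lastp wx; have Cq := component_adj Cw wq.
  have [eq_q|neq_q] := eqVneq (med x y w) (med x y q).
    by apply: IHp Cq qp lastp _; rewrite -eq_q.
  by exists q => //; rewrite -[X in adj X _]wx; rewrite med_adj ?CS.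
exists (med x y q); split; rewrite ?med_component //.
have [Sm mE] := medP (CS Cx) (CS Cy) (CS Cq).
move: (adj_q); rewrite (adj_l1 (CS Cx) Sm) // => /eqP <-.
by rewrite -big_split; apply: eq_bigr => t _ /=; rewrite mE medz_between.
Qed.

Lemma walk_l1dist (u v : induced C) n :
  walk u v n -> l1dist (val u) (val v) <= c * n.
Proof.
move=> /walkP[p [<- up <-]]; elim: p u up => [|w p IHp] u /=.
  by move=> _; rewrite /l1dist big1 // => t _; rewrite subrr.
move=> /andP[uw wp]; rewrite mulnS; apply: leq_trans (l1dist_triangle (val w) _ _) _.
apply: leq_add (IHp _ wp).
move: uw; rewrite /= /induced_adj (adj_l1 (CS (valP u)) (CS (valP w))).
by move=> /eqP ->.
Qed.

(** Greedy descent by [component_step] attains the lower bound of [walk_l1dist]. *)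
Lemma l1dist_walk (u v : induced C) :
  exists2 n, walk u v n & l1dist (val u) (val v) = c * n.
Proof.
have [m] := ubnP (l1dist (val u) (val v)); elim: m u => // m IHm u le_m.
have [<-|neq] := eqVneq u v.
  exists 0; first by apply/walkP; exists [::].
  by rewrite muln0 /l1dist big1 // => t _; rewrite subrr.
have [w [Cw uw uvE]] := component_step (valP u) (valP v) neq.
have [|n /walkP[p [<- wp pv]] wvE] := IHm (Sub w Cw).
  by move: le_m; rewrite uvE /=; lia.
exists (size p).+1; last by rewrite uvE wvE mulnS.
by apply/walkP; exists (Sub w Cw :: p); split=> //=; rewrite wp andbT.
Qed.

Lemma gdist_l1dist (u v : induced C) : c * gdist u v = l1dist (val u) (val v).
Proof.
have [n uvn dE] := l1dist_walk u v; rewrite (gdist_min_walk uvn) // => m uvm.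
by rewrite -(leq_pmul2l c_gt0) -dE walk_l1dist.
Qed.

Lemma interval_l1dist (u v w : induced C) : (w \in Defs.interval u v) =
  (l1dist (val u) (val w) + l1dist (val w) (val v) == l1dist (val u) (val v)).
Proof. by rewrite inE -!gdist_l1dist -mulnDr eqn_pmul2l. Qed.

(** Since [l1dist] is [c] times [gdist], membership in an interval is decided coordinate by
    coordinate, and there the three integer intervals share exactly the median. *)
Theorem median_component : median (induced C).
Proof.
split=> [u v|u v w].
  have [n /walkP[p [_ up <-]] _] := l1dist_walk u v.
  by apply/connectP; exists p.
pose m : induced C := exist _ (med (\val u) (\val v) (\val w))
  (med_component (valP u) (valP v) (valP w)).
have [Sm mE] := medP (CS (valP u)) (CS (valP v)) (CS (valP w)).
apply/eqP/cards1P; exists m; apply/setP=> z; rewrite !(inE, interval_l1dist).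
apply/idP/eqP => [/andP[/andP[/eqP uv /eqP vw] /eqP wu]|->].
  apply/val_inj/(phi_inj (CS (valP z)) Sm) => t; rewrite mE.
  by apply: medz_unique; apply: l1dist_tight.
rewrite -!big_split /=.
apply/andP; split; [apply/andP; split|]; apply/eqP/eq_bigr => t _; rewrite mE.
- exact: medz_between.
- rewrite medz_rot; exact: medz_between.
- rewrite -medz_rot; exact: medz_between.
Qed.

End MedianStable.

(** * Darts, edges and face tracing *)

Section Heights.

Variable G : plane_graph.
Implicit Types (d : G * G) (M N P : {set {set G}}) (k : {ffun G * G -> int}).

Local Notation step := (face_step (@Defs.rot G)).

Definition drev d : G * G := (d.2, d.1).
Definition dedge d : {set G} := [set d.1; d.2].

Lemma dedge_rev d : dedge (drev d) = dedge d.
Proof. by rewrite /dedge setUC. Qed.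

Lemma dedge_eq d d' : dedge d = dedge d' -> d = d' \/ d = drev d'.
Proof.
case: d d' => [a b] [x y]; rewrite /dedge /drev /= => /setP eq_e.
move: (eq_e a) (eq_e b) (eq_e x) (eq_e y); rewrite !inE !eqxx !orbT /=.
move=> /esym/orP[]/eqP -> /esym/orP[]/eqP ->; rewrite ?eqxx ?orbb; auto.
- by move=> _ /eqP ->; left.
- by move=> /eqP -> _; left.
Qed.

Lemma dedge_edges d : (dedge d \in edges G) = adj d.1 d.2.
Proof.
apply/imsetP/idP => [[d'] | dadj]; last by exists d; rewrite ?inE.
by rewrite inE => d'adj /dedge_eq[->|->] //; rewrite adj_sym.
Qed.

Lemma rot_adj (v u : G) : adj v (Defs.rot v u) = adj v u.
Proof.
have rotE w : adj v w -> porbit (Defs.rot v) w = neighbours v by apply: rot_system.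
apply/idP/idP => vu.
  have : u \in porbit (Defs.rot v) (Defs.rot v u) by rewrite porbit_sym (mem_porbit _ 1).
  by rewrite (rotE _ vu) inE.
have : Defs.rot v u \in porbit (Defs.rot v) u by apply: (mem_porbit _ 1).
by rewrite (rotE _ vu) inE.
Qed.

Lemma step_inj : injective step.
Proof. by move=> [a b] [c d] [-> /perm_inj ->]. Qed.

Definition face d : {set G * G} := [set d' | fconnect step d d'].

Lemma face_step_in d d' : (step d' \in face d) = (d' \in face d).
Proof. by rewrite !inE -(same_fconnect1_r step_inj). Qed.

Lemma face_adj d d' : d' \in face d -> adj d'.1 d'.2 = adj d.1 d.2.
Proof.
rewrite inE => /iter_findex <-.
by elim: (findex _ _ _) => //= n IHn; rewrite rot_adj adj_sym.
Qed.

Lemma facesP (F : {set G * G}) :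
  reflect (exists2 d, adj d.1 d.2 & F = face d) (F \in faces G).
Proof.
apply: (iffP imsetP) => -[d]; first by rewrite inE => dadj ->; exists d.
by move=> dadj ->; exists d; rewrite ?inE.
Qed.

Lemma gon_fst_inj n (F : {set G * G}) : is_gon n F -> {in F &, injective fst}.
Proof. by case/andP=> /eqP <- /imset_injP. Qed.

(** * Matchings as 0-1 functions on darts, and heights between them *)

Definition chi M d : int := Posz (dedge d \in M).

Lemma chi_rev M d : chi M (drev d) = chi M d.
Proof. by rewrite /chi dedge_rev. Qed.

Lemma chi_inj M N : M \subset edges G -> N \subset edges G ->
  chi M =1 chi N -> M = N.
Proof.
move=> ME NE MN; apply/setP=> e.
have [/imsetP[d _ ->]|eN] := boolP (e \in edges G).
  by have := MN d; rewrite /chi; do 2!case: (_ \in _).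
by rewrite (contraNF (subsetP ME e)) // (contraNF (subsetP NE e)).
Qed.

(** This makes the matching condition at [x] linear; vertices not adjacent to [x] contribute 0
    because [M] consists of edges. *)
Lemma matching_edge_sum M (x : G) : M \subset edges G ->
  Posz #|[set e in M | x \in e]| = (\sum_u chi M (x, u))%R.
Proof.
move=> ME; have -> : [set e in M | x \in e] =
    [set [set x; u] | u in [set u | [set x; u] \in M]].
  apply/setP=> e; apply/idP/imsetP => [|[u]]; rewrite !inE; last first.
    by move=> uM ->; rewrite uM set21.
  case/andP=> eM; have /imsetP[d _ eE] := subsetP ME e eM.
  rewrite eE !inE => /orP[]/eqP xE.
    by exists d.2; rewrite ?inE xE -?eE.
  by exists d.1; rewrite ?inE xE setUC -?eE.
rewrite card_in_imset => [|u v _ _ /(@dedge_eq (x, u) (x, v)) []]; last 2 first.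
- by case.
- by case=> -> ->.
rewrite -sum1dep_card big_mkcond /= (big_morph Posz PoszD (erefl _)).
by apply: eq_bigr => u _; rewrite /chi /dedge /=; case: (_ \in M).
Qed.

Lemma perfect_matchingP M :
  reflect (M \subset edges G /\ forall x, (\sum_u chi M (x, u) = 1)%R)
          (perfect_matching M).
Proof.
apply: (iffP andP) => -[ME]; first move=> /forallP Mx; last move=> Mx.
  by split=> // x; rewrite -matching_edge_sum // (eqP (Mx x)).
split=> //; apply/forallP=> x.
by have := Mx x; rewrite -matching_edge_sum // => -[->].
Qed.

Lemma matching_unique M (x : G) (e e' : {set G}) : perfect_matching M ->
  e \in M -> x \in e -> e' \in M -> x \in e' -> e = e'.
Proof.
case/andP=> _ /forallP/(_ x)/cards1P[e0 Me0] eM xe e'M xe'.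
have : e \in [set e in M | x \in e] by rewrite inE eM.
have : e' \in [set e in M | x \in e] by rewrite inE e'M.
by rewrite Me0 !inE => /eqP-> /eqP->.
Qed.

(** Lifting the face-wise flip counts to darts, with the sign alternating along
    each face, avoids choosing a sign convention for every hexagon and forces
    the value [0] on pentagons. *)
Definition height M N k : bool :=
  [forall d, [&& k (step d) == - k d, adj d.1 d.2 || (k d == 0)
              & chi N d == chi M d + k d + k (drev d)]]%R.

Lemma heightP M N k : reflect
  [/\ forall d, k (step d) = (- k d)%R, forall d, ~~ adj d.1 d.2 -> k d = 0%R
    & forall d, chi N d = (chi M d + k d + k (drev d))%R] (height M N k).
Proof.
apply: (iffP forallP) => [hk|[k1 k2 k3] d].
  split=> d; have /and3P[/eqP k1 k2 /eqP k3] := hk d => //.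
  by move/negPf=> nd; move: k2; rewrite nd => /eqP.
by rewrite k1 k3 !eqxx andbT /=; have [//|/k2->] := boolP (adj _ _).
Qed.

Lemma height0 M : height M M [ffun => 0%R].
Proof. by apply/heightP; split=> d; rewrite !ffunE; lia. Qed.

Lemma height_add M N P k k' : height M N k -> height N P k' ->
  height M P [ffun d => (k d + k' d)%R].
Proof.
case/heightP=> k1 k2 k3 /heightP[k1' k2' k3'].
apply/heightP; split=> d; rewrite !ffunE.
- by rewrite k1 k1'; lia.
- by move=> nd; rewrite k2 ?k2'.
- by rewrite k3' k3; lia.
Qed.

Lemma height_sub M N P k k' : height M N k -> height M P k' ->
  height N P [ffun d => (k' d - k d)%R].
Proof.
case/heightP=> k1 k2 k3 /heightP[k1' k2' k3'].
apply/heightP; split=> d; rewrite !ffunE.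
- by rewrite k1 k1'; lia.
- by move=> nd; rewrite k2 ?k2'.
- by rewrite k3' k3; lia.
Qed.

(** * Flips of hexagons as heights of norm 6 *)

Lemma rot_neq (v u : G) : cubic G -> adj v u -> Defs.rot v u != u.
Proof.
move=> /(_ v) card_v /(@rot_system G _ _) orb; apply/eqP=> fix_u.
suff /subset_leq_card : neighbours v \subset [set u] by rewrite cards1 card_v.
rewrite -orb; apply/subsetP=> w /porbitP[n ->]; rewrite inE permX.
by rewrite iter_fix.
Qed.

Lemma dedge_step_neq d : cubic G -> adj d.1 d.2 -> dedge (step d) != dedge d.
Proof.
case: d => a b cubG /= ab; apply/eqP=> /dedge_eq[] [].
  by move=> ba; move: ab; rewrite ba adj_irrefl.
by move/eqP; apply/negP; rewrite rot_neq // adj_sym.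
Qed.

(** Otherwise [step d'] and [drev d'] are darts of the face with the same start, hence equal, and
    [rot] fixes a neighbour. *)
Lemma gon_rev n d d' : cubic G -> adj d.1 d.2 -> is_gon n (face d) ->
  d' \in face d -> drev d' \notin face d.
Proof.
move=> cubG dadj gon d'F; apply/negP=> revF.
have stepF : step d' \in face d by rewrite face_step_in.
have /eqP := gon_fst_inj gon revF stepF (erefl _); apply/negP.
rewrite xpair_eqE eqxx /= eq_sym rot_neq // adj_sym.
by rewrite (face_adj d'F).
Qed.

Definition norm k : nat := \sum_d `|k d|.

Lemma resonant_height (A B : matching G) : cubic G -> resonant A B ->
  exists2 k, height (val A) (val B) k & norm k = 6.
Proof.
move=> cubG /existsP[F /andP[/facesP[d0 d0adj ->{F}] /andP[gon6 /eqP AB]]].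
have Fadj d : d \in face d0 -> adj d.1 d.2 by move/face_adj->.
have diffF d : d \in face d0 -> (dedge d \in val A) != (dedge d \in val B).
  move=> dF; have : dedge d \in boundary (face d0) by apply: imset_f.
  by rewrite -AB !inE; do 2!case: (dedge d \in _).
(* Consecutive edges share [d.2], so a matching contains at most one of them, while each edge lies
   in exactly one of [A] and [B]. *)
have alt d : d \in face d0 -> (dedge (step d) \in val A) = (dedge d \in val B).
  move=> dF; have sF : step d \in face d0 by rewrite face_step_in.
  have vd : d.2 \in dedge d by rewrite !inE eqxx orbT.
  have vs : d.2 \in dedge (step d) by rewrite !inE eqxx.
  have uniqm (m : matching G) : ~~ ((dedge (step d) \in val m) && (dedge d \in val m)).
    apply: contra (dedge_step_neq cubG (Fadj d dF)) => /andP[sm dm].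
    exact/eqP/(matching_unique (valP m) sm vs dm vd).
  move: (uniqm A) (uniqm B) (diffF _ dF) (diffF _ sF).
  by do 2!case: (_ \in val A); do 2!case: (_ \in val B).
(* The whole change at an edge is charged to its dart on the face; by [gon_rev] the reverse dart is
   off the face and gets 0. *)
exists [ffun d => if d \in face d0 then chi (val B) d - chi (val A) d else 0]%R.
  apply/heightP; split=> d; rewrite !ffunE.
  - rewrite face_step_in; case: ifP => dF; last by rewrite oppr0.
    have sF : step d \in face d0 by rewrite face_step_in.
    have := alt d dF; have := diffF _ dF; have := diffF _ sF; rewrite /chi.
    by do 4!case: (_ \in _).
  - by case: ifP => // /Fadj ->.
  rewrite chi_rev chi_rev; case: ifP => dF.
    by rewrite (negPf (gon_rev cubG d0adj gon6 dF)); lia.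
  case: ifP => rF; first by lia.
  rewrite !addr0 /chi; have : dedge d \notin boundary (face d0).
    apply/imsetP=> -[d' d'F /dedge_eq[] dd']; first by rewrite dd' d'F in dF.
    by move: rF; rewrite dd' /drev -surjective_pairing d'F.
  by rewrite -AB !inE; do 2!case: (dedge d \in _).
case/andP: (gon6) => /eqP <- _; rewrite -sum1_card [RHS]big_mkcond.
apply: eq_bigr => d _; rewrite ffunE; case: ifP => // /diffF.
by rewrite /chi; do 2!case: (_ \in _).
Qed.

Lemma height_face M N k d d' :
  height M N k -> d' \in face d -> `|k d'| = `|k d|.
Proof.
case/heightP=> k_step _ _; rewrite inE => /iter_findex <-.
by elim: (findex _ _ _) => //= n <-; rewrite k_step; lia.
Qed.

(** Five sign changes lead back to [d], so [k d = - k d]. *)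
Lemma height_pentagon M N k d :
  height M N k -> is_gon 5 (face d) -> k d = 0%R.
Proof.
case/heightP=> k_step _ _ /andP[/eqP card5 _].
have : iter 5 step d = d.
  rewrite -[RHS](iter_order step_inj d) /order -card5.
  by congr (iter _ _ _); apply: eq_card => d'; rewrite inE.
by move/(congr1 k); rewrite /= !k_step; lia.
Qed.

Lemma sum_face M N k d : height M N k -> is_gon 6 (face d) ->
  \sum_(d' in face d) `|k d'| = 6 * `|k d|.
Proof.
move=> hk /andP[/eqP card6 _]; rewrite -card6 -sum_nat_const.
by apply: eq_bigr => d' /(height_face hk).
Qed.

Lemma height_hexagon M N k d : fullerene G -> height M N k -> k d != 0%R ->
  is_gon 6 (face d).
Proof.
case=> _ _ gons hk kd; have dadj : adj d.1 d.2.
  by case/heightP: hk => _ k0 _; apply: contraNT kd => /k0 ->.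
have /gons/orP[/(height_pentagon hk) k0|//] : face d \in faces G.
  by apply/facesP; exists d.
by rewrite k0 eqxx in kd.
Qed.

Lemma norm_face k d :
  norm k = \sum_(d' in face d) `|k d'| + \sum_(d' | d' \notin face d) `|k d'|.
Proof. by rewrite /norm (bigID (mem (face d))). Qed.

(** A nonzero value recurs, up to sign, on all six darts of its hexagon. *)
Lemma norm_gap M N k d : fullerene G -> height M N k -> k d != 0%R ->
  6 <= norm k.
Proof.
move=> fulG hk kd; rewrite (norm_face k d) (sum_face hk) ?(height_hexagon fulG hk) //.
by lia.
Qed.

(** The hexagon of one nonzero dart exhausts the norm, so [k] is 1 or -1 on it and 0 elsewhere; the
    edges that change are those of its boundary. *)
Lemma height_resonant (A B : matching G) k : fullerene G ->
  height (val A) (val B) k -> norm k = 6 -> resonant A B.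
Proof.
move=> fulG hk norm6; have [cubG _ _] := fulG.
have [d kd] : exists d, k d != 0%R.
  apply/existsP; apply: contra_eqT norm6 => /existsPn k0.
  by rewrite /norm big1 // => d _; have /negPn/eqP -> := k0 d.
have gon6 := height_hexagon fulG hk kd.
have dadj : adj d.1 d.2.
  by case/heightP: hk => _ k0 _; apply: contraNT kd => /k0 ->.
move: norm6; rewrite (norm_face k d) (sum_face hk gon6) => norm6.
have kd1 : `|k d| = 1 by lia.
have kF d' : d' \in face d -> `|k d'| = 1 by move/(height_face hk)->.
have k0 d' : d' \notin face d -> k d' = 0%R.
  move=> d'F; suff : `|k d'| <= 0 by lia.
  have {norm6} <- : \sum_(d' | d' \notin face d) `|k d'| = 0 by lia.
  by rewrite (bigD1 d') //= leq_addr.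
apply/existsP; exists (face d); rewrite gon6 andTb.
apply/andP; split; first by apply/facesP; exists d.
have [_ _ chiE] := heightP _ _ _ hk.
apply/eqP/setP=> e; have [/imsetP[d' _ ->]|eN] := boolP (e \in edges G); last first.
  rewrite !inE; have /andP[AE _] := valP A; have /andP[BE _] := valP B.
  rewrite (contraNF (subsetP AE e)) // (contraNF (subsetP BE e)) //=.
  apply/esym/negP => /imsetP[d' d'F eE]; case/negP: eN.
  by rewrite eE dedge_edges (face_adj d'F).
have := chiE d'; rewrite /chi -/(dedge d') !inE => chid'.
apply/idP/imsetP=> [AB|[d'' d''F d'E]].
  have [d'F|/k0 kd'] := boolP (d' \in face d); first by exists d'.
  exists (drev d'); last by rewrite -/(dedge (drev d')) dedge_rev.
  apply: contraLR AB => /k0 krd'; move: chid'; rewrite kd' krd' !addr0.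
  by do 2!case: (_ \in _).
have := chiE d''; rewrite /chi; rewrite [dedge d'']/dedge -d'E.
rewrite (k0 (drev d'')) ?(gon_rev cubG dadj gon6) // addr0.
by have := kF d'' d''F; do 2!case: (_ \in _) => //=; lia.
Qed.

(** * Counting darts, and heights determined by their matchings *)

Lemma card_darts : cubic G -> #|[set d : G * G | adj d.1 d.2]| = 3 * #|G|.
Proof.
move=> cubG; rewrite -sum1dep_card -(pair_big_dep xpredT (@adj G) (fun _ _ => 1)) /=.
rewrite mulnC -sum_nat_const; apply: eq_bigr => x _.
by rewrite -(cubG x) sum1dep_card.
Qed.

Lemma card_darts_edges :
  #|[set d : G * G | adj d.1 d.2]| <= 2 * #|edges G|.
Proof.
rewrite -sum1dep_card (partition_big dedge (mem (edges G))) => [|d] /=; last first.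
  by rewrite dedge_edges.
rewrite mulnC -sum_nat_const; apply: leq_sum => e /imsetP[d _ ->].
rewrite sum1dep_card; apply: leq_trans (_ : #|[set d; drev d]| <= 2).
  by apply/subset_leq_card/subsetP=> d'; rewrite !inE => /andP[_ /eqP/dedge_eq[->|->]];
    rewrite eqxx ?orbT.
by rewrite cards2; case: (_ != _).
Qed.

Lemma card_faces n : (forall F, F \in faces G -> #|F| = n) ->
  #|[set d : G * G | adj d.1 d.2]| = #|faces G| * n.
Proof.
move=> cardF; apply: card_uniform_partition => //.
suff -> : faces G = equivalence_partition (fconnect step) [set d | adj d.1 d.2].
  apply: equivalence_partitionP => d d' d'' _ _ _; split=> // dd'.
  exact: (same_connect (fconnect_sym step_inj) dd').
apply: eq_in_imset => d; rewrite inE => dadj; apply/setP=> d'; rewrite !inE.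
have [dd'|] := boolP (fconnect _ _ _); rewrite ?andbF // andbT.
by rewrite (@face_adj d) ?inE.
Qed.

(** With hexagons only, [3V = 6F] and Euler's formula give [3V = 2E + 4], against [3V <= 2E] from
    counting darts by edges. *)
Lemma pentagon_exists : fullerene G ->
  exists2 d, adj d.1 d.2 & is_gon 5 (face d).
Proof.
case=> cubG _ gons.
have [/exists_inP[F /facesP[d dadj ->] gon5]|no5] :=
  boolP [exists F in faces G, is_gon 5 F]; first by exists d.
have card6 F : F \in faces G -> #|F| = 6.
  move=> FG; have /orP[gon5|/andP[/eqP]//] := gons F FG.
  by case/exists_inP: no5; exists F.
have := card_faces card6; have := card_darts_edges.
have [_] := rot_spherical G; rewrite -/(faces G) card_darts //.
by lia.
Qed.

(** With vanishing change of matching, [k] is antisymmetric under [step] and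
    under [drev], which together act transitively on the darts, so the zero at
    a pentagon propagates. *)
Lemma height_self M k : fullerene G -> height M M k -> forall d, k d = 0%R.
Proof.
move=> fulG hk; have [k_step k_adj chiE] := heightP _ _ _ hk.
have k_rev d : k d = 0%R -> k (drev d) = 0%R by have := chiE d; lia.
(* As [step (u, v)] is [(v, rot v u)], a zero at [(v, u)] passes through [(u, v)] to the next dart
   around [v]. *)
have k_vertex (v u : G) : adj v u -> k (v, u) = 0%R -> forall w, k (v, w) = 0%R.
  move=> vu kvu w; have [vw|] := boolP (adj v w); last exact: (k_adj (v, w)).
  have : w \in porbit (Defs.rot v) u by rewrite (rot_system vu) inE.
  case/porbitP=> n ->; elim: n => [|n IHn]; first by rewrite perm1.
  by rewrite expgSr permM; have := k_step (_, v); rewrite /face_step /= => ->;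
    rewrite (k_rev (v, _)) ?oppr0.
have [[a b] /= ab gon5] := pentagon_exists fulG.
have ka := k_vertex a b ab (height_pentagon hk gon5).
case=> v w; have [Gconn _] := rot_spherical G.
have /connectP[p ap ->] := Gconn a v.
elim: p a ka {ab gon5} ap w => //= c p IHp a ka /andP[ac cp].
apply: IHp cp; apply: (k_vertex c a); first by rewrite adj_sym.
exact: (k_rev (a, c)).
Qed.

(** * Realising integer solutions by matchings, and closure under medians *)

Lemma matching_of_height (A : matching G) k :
  (forall d, k (step d) = - k d)%R -> (forall d, ~~ adj d.1 d.2 -> k d = 0%R) ->
  (forall d, 0 <= chi (val A) d + k d + k (drev d) <= 1)%R ->
  exists B : matching G, height (val A) (val B) k.
Proof.
move=> k_step k_adj k_bound.
have /perfect_matchingP[AE Asum] := valP A.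
pose B := [set dedge d | d in [pred d | chi (val A) d + k d + k (drev d) == 1]%R].
have chiB d : chi B d = (chi (val A) d + k d + k (drev d))%R.
  have B_rev d' : (chi (val A) (drev d') + k (drev d') + k (drev (drev d')))%R
                = (chi (val A) d' + k d' + k (drev d'))%R.
    by rewrite chi_rev /drev -surjective_pairing; lia.
  have := k_bound d; rewrite [chi B d]/chi.
  have [/imsetP[d']|dB] := boolP (dedge d \in B).
    by rewrite inE => /eqP d'1 /dedge_eq[]->; rewrite ?B_rev d'1.
  have : (chi (val A) d + k d + k (drev d) != 1)%R.
    by apply: contraNneq dB => d1; apply/imsetP; exists d; rewrite ?inE ?d1.
  by lia.
have pmB : perfect_matching B.
  apply/perfect_matchingP; split.
    apply/subsetP=> e /imsetP[d]; rewrite inE => d1 ->; rewrite dedge_edges.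
    apply: contraLR d1 => nd; rewrite (k_adj d) // (k_adj (drev d)) /= 1?adj_sym //.
    by rewrite /chi (contraNF (subsetP AE _)) // dedge_edges.
  move=> x; under eq_bigr do rewrite chiB.
  (* Reindexed by [rot x], the outgoing darts become [step (u, x)], whose values cancel those of the
     incoming [(u, x)]. *)
  rewrite !big_split /= Asum (reindex_inj (@perm_inj _ (Defs.rot x))) /=.
  rewrite -[RHS]addr0 -addrA; congr (_ + _)%R; rewrite -big_split big1 // => u _ /=.
  by have := k_step (u, x); rewrite /face_step /= => ->; rewrite addNr.
by exists (Sub B pmB); apply/heightP; split.
Qed.

(** Medians commute with negation. For the upper bound, in each coordinate two of the three pairs
    [(k d, k (drev d))] are at least the median, so some pair is so in both; the lower bound is
    dual. *)
Lemma height_median (O A B C : matching G) a b c : height (val O) (val A) a ->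
  height (val O) (val B) b -> height (val O) (val C) c ->
  exists D : matching G,
    height (val O) (val D) [ffun d => medz (a d) (b d) (c d)].
Proof.
case/heightP=> a1 a2 a3 /heightP[b1 b2 b3] /heightP[c1 c2 c3].
apply: matching_of_height => d; rewrite !ffunE.
- by rewrite a1 b1 c1 /medz; lia.
- by move=> nd; rewrite a2 // b2 // c2.
have chi01 M : (0 <= chi M d <= 1)%R by rewrite /chi; case: (_ \in _).
have := chi01 (val A); have := chi01 (val B); have := chi01 (val C).
rewrite a3 b3 c3 /medz; lia.
Qed.

End Heights.

Theorem corollary5p3 (G : plane_graph) (hG : fullerene G)
  (C : {set resonance_graph G}) (hC : C \in components (resonance_graph G)) :
  median (induced (H := resonance_graph G) C).
Proof.
have [cubG _ _] := hG; have /imsetP[O _ CE] := hC.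
(* One height from the base matching [O] is fixed for each matching that has one. *)
have /boolp.choice[h hP] (A : matching G) : exists h,
    (exists k, height (val O) (val A) k) ->
    height (val O) (val A) h.
  by have [[k hk]|noh] := pselect (exists k, height (val O) (val A) k);
    [exists k|exists [ffun=> 0%R]].
(* Membership asks for a height from [O] rather than for a path of flips, which makes closure under
   medians immediate from [height_median]. *)
pose S : {set resonance_graph G} := [set A | `[< exists k, height (val O) (val A) k >]].
have SP A : A \in S -> height (val O) (val A) (h A) by rewrite inE => /asboolP /hP.
have diffE A B : A \in S -> B \in S ->
  height (val A) (val B) [ffun d => h B d - h A d]%R.
  by move=> /SP hA /SP hB; apply: height_sub hA hB.
pose f (A : resonance_graph G) (d : G * G) : int := h A d.
have normE A B : norm [ffun d => h B d - h A d]%R = l1dist f A B.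
  by apply: eq_bigr => d _; rewrite ffunE /f; lia.
(* The constant is 6 because a flip changes the height by one on each of six darts. *)
apply: (@median_component _ _ S f 6) => //.
- move=> A B SA SB; apply/idP/eqP => [AB|dAB]; last first.
    by apply: (height_resonant hG (diffE A B SA SB)); rewrite normE.
  have [k hk <-] := resonant_height cubG AB.
  (* Two heights from [A] to [B] differ by a height from [B] to itself, which vanishes. *)
  rewrite -normE; congr norm; apply/ffunP=> d; rewrite ffunE.
  have := height_self hG (height_sub hk (diffE A B SA SB)) d.
  by rewrite !ffunE => /eqP; rewrite subr_eq0 => /eqP.
- move=> A B SA SB neqAB; rewrite -normE.
  have hAB := diffE A B SA SB.
  have [/existsP[d kd]|/existsPn k0] :=
    boolP [exists d, [ffun d => h B d - h A d]%R d != 0%R].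
    exact: norm_gap hG hAB kd.
  case/eqP: neqAB; apply/val_inj.
  have /andP[AE _] := valP A; have /andP[BE _] := valP B.
  apply: chi_inj => // d; have [_ _ ->] := heightP _ _ _ hAB.
  by have /negPn/eqP -> := k0 d; have /negPn/eqP -> := k0 (drev d); rewrite !addr0.
- move=> A B D SA SB SD.
  have [E hE] := height_median (SP A SA) (SP B SB) (SP D SD).
  have SE : E \in S by rewrite inE; apply/asboolP; eexists; apply: hE.
  exists E => // d.
  have := height_self hG (height_sub hE (SP E SE)) d.
  by rewrite !ffunE => /eqP; rewrite subr_eq0 => /eqP.
(* The heights of the flips on a path from [O] add up to a height from [O]. *)
apply/subsetP=> A; rewrite CE inE => /connectP[p Op ->]{A}.
have : O \in S by rewrite inE; apply/asboolP; exists [ffun=> 0%R]; apply: height0.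
elim: p {1 2 3}O Op => //= B p IHp A /andP[AB Bp] SA; apply: IHp Bp _.
have [k hk _] := resonant_height cubG AB.
by rewrite inE; apply/asboolP; eexists; apply: height_add (SP A SA) hk.
Qed.
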